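(* Let $X$ be a Hausdorff space. Then $X$ is H-closed if and only if for every filter base $\mathcal F$ on $X$, $a_c(\mathcal F)\neq\varnothing$.
   Context: A Hausdorff space $X$ is H-closed if every open cover $\mathcal V$ of $X$ has a finite subfamily $\mathcal W$ with $X=\bigcup_{W\in\mathcal W}cl\,W$. An open ultrafilter on a Hausdorff space $X$ is a maximal filter in the family of open subsets of $X$ (its members are nonempty open sets); it converges to $x\in X$ if it contains every open set containing $x$. $EX$ is the set of all convergent open ultrafilters on $X$. A section is a function $b:X\to EX$ such that $b(x)$ converges to $x$ for every $x\in X$. For a section $b$ and an open set $U$ let $\widehat{U}_b=\{x\in X: U\in b(x)\}$, and for $A\subseteq X$ let $c_b(A)=\{x\in X:\widehat{U}_b\cap A\neq\varnothing\text{ for every open }U\ni x\}$. $A$ is $c_b$-closed if $c_b(A)=A$. For $A\subseteq X$, $aL(A,X)$ is the least infinite cardinal $\kappa$ such that every cover $\mathcal V$ of $A$ by open sets of $X$ has a subfamily $\mathcal W$ with $|\mathcal W|\leq\kappa$ and $A\subseteq\bigcup_{W\in\mathcal W}cl\,W$. Put $aL^b(X)=\sup\{aL(C,X): C\text{ is }c_b\text{-closed}\}+\aleph_0$ and $aL'(X)=\min\{aL^b(X): b\text{ a section}\}$. Fix any section $b'$ with $aL^{b'}(X)=aL'(X)$ and write $c=c_{b'}$. The $c$-adherence of a filter base $\mathcal F$ on $X$ is $a_c(\mathcal F)=\bigcap\{c(F):F\in\mathcal F\}$. *)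

(* Defs.v *)
From HB Require Import structures.
From mathcomp Require Import all_boot all_order all_algebra.
From mathcomp Require Import all_classical topology.

Set Implicit Arguments.
Unset Strict Implicit.
Unset Printing Implicit Defensive.

Local Open Scope classical_set_scope.
Local Open Scope card_scope.

(* Cardinals are represented by types, compared through injections
   ([set: K] #<= [set: L]) and identified up to bijection
   ([set: K] #= [set: L]).  A cardinal invariant is accordingly a predicate
   on types, "is_inv K" meaning "K has cardinality inv". *)

Definition is_card_least (P : Type -> Prop) (K : Type) : Prop :=
  P K /\ forall L : Type, P L -> [set: K] #<= [set: L].

Definition is_card_sup (P : Type -> Prop) (K : Type) : Prop :=
  is_card_least
    (fun U : Type => forall L : Type, P L -> [set: L] #<= [set: U]) K.

Section Spaces.
Variable T : topologicalType.
Implicit Types (A C U : set T) (F G V W : set (set T)) (x : T).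

Definition open_cover V A : Prop := V `<=` open /\ A `<=` \bigcup_(U in V) U.

(* Covering property only: the Hausdorff axiom that is part of the usual
   definition of H-closed is a separate hypothesis. *)
Definition H_closed : Prop :=
  forall V, open_cover V setT ->
  exists W, [/\ W `<=` V, finite_set W & setT = \bigcup_(U in W) closure U].

Record open_filter F : Prop := OpenFilter {
  open_filter_open : F `<=` open ;
  open_filter_nonempty : forall U, F U -> U !=set0 ;
  open_filterT : F setT ;
  open_filterI : forall U U', F U -> F U' -> F (U `&` U') ;
  open_filterS : forall U U', F U -> open U' -> U `<=` U' -> F U' }.

Definition open_ultrafilter F : Prop :=
  open_filter F /\ forall G, open_filter G -> F `<=` G -> G = F.

Definition open_converges F x : Prop := forall U, open U -> U x -> F U.

Definition EX : set (set (set T)) :=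
  [set F | open_ultrafilter F /\ exists x, open_converges F x].

Definition is_section (b : T -> EX) : Prop :=
  forall x, open_converges (\val (b x)) x.

Definition hat (b : T -> EX) U : set T := [set x | (\val (b x)) U].

Definition c_op (b : T -> EX) A : set T :=
  [set x | forall U, open U -> U x -> hat b U `&` A !=set0].

Definition c_closed (b : T -> EX) A : Prop := c_op b A = A.

Definition is_aL A (K : Type) : Prop :=
  is_card_least (fun L : Type =>
    infinite_set [set: L] /\
    forall V, open_cover V A ->
    exists W, [/\ W `<=` V, W #<= [set: L]
                & A `<=` \bigcup_(U in W) closure U]) K.

(* The sum type S + nat is the cardinal sum of S and aleph_0. *)
Definition is_aLb (b : T -> EX) (K : Type) : Prop :=
  exists S : Type,
    is_card_sup (fun L : Type => exists2 C, c_closed b C & is_aL C L) S /\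
    [set: K] #= [set: (S + nat)%type].

Definition is_aL' (K : Type) : Prop :=
  is_card_least (fun L : Type => exists2 b, is_section b & is_aLb b L) K.

Definition filter_base F : Prop :=
  [/\ F !=set0, forall A, F A -> A !=set0
    & forall A C, F A -> F C -> exists2 D, F D & D `<=` A `&` C].

Definition adherence (c : set T -> set T) F : set T := \bigcap_(A in F) c A.

End Spaces.

Arguments H_closed : clear implicits.
Arguments EX : clear implicits.
Arguments is_aL' : clear implicits.

(* Main.v *)
Require Import Defs.
From HB Require Import structures.
From mathcomp Require Import all_boot all_order all_algebra.
From mathcomp Require Import all_classical topology.

Set Implicit Arguments.
Unset Strict Implicit.
Unset Printing Implicit Defensive.

Local Open Scope classical_set_scope.

(** Write [b] for the section.  If [setT] is a finite union of closures of open
    sets, then every open ultrafilter contains one of these sets [U], so the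
    sets [hat b U] cover the space; if the adherence of [F] is empty, the open
    [U] such that [hat b U] misses a member of [F] cover the space, and finitely
    many hats covering it would all miss a common member of [F].  Conversely
    [hat b U] is contained in [closure U], so the complements of the finite
    unions of closures of members of a cover without the required finite
    subfamily form a filter base with empty adherence. *)

Lemma filter_base_bigcap (T : topologicalType) (I : choiceType)
    (F : set (set T)) (D : set I) (A : I -> set T) :
  filter_base F -> finite_set D -> (forall i, D i -> F (A i)) ->
  exists2 E, F E & E `<=` \bigcap_(i in D) A i.
Proof.
move=> [F0 _ FI] /finite_fsetP[X ->] FA.
have FF : Filter (filter_from F id) by exact: filter_from_filter.
by apply: (@filter_bigI _ _ X A _ FF) => i Xi; exists (A i) => //; apply: FA.
Qed.

Lemma open_filter_base (T : topologicalType) (F : set (set T)) :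
  open_filter F -> filter_base F.
Proof.
move=> Fo; split; [by exists setT; exact: open_filterT Fo
                  | exact: open_filter_nonempty Fo|].
by move=> A C FA FC; exists (A `&` C) => //; exact: (open_filterI Fo FA FC).
Qed.

(** By maximality: the open sets including a trace [A]&[U] with [A] in [F] form an open filter [G]
    that extends [F] and contains [U], so [G] is [F] itself. *)
Lemma open_ultrafilter_meets (T : topologicalType) (F : set (set T))
    (U : set T) :
  open_ultrafilter F -> open U -> (forall A, F A -> A `&` U !=set0) -> F U.
Proof.
move=> [Fo Fmax] oU FU.
pose G := [set O : set T | open O /\ exists2 A, F A & A `&` U `<=` O].
suff <- : G = F.
  by split=> //; exists setT; [exact: open_filterT Fo | move=> x []].
apply: Fmax; last first.
  move=> A FA; split; first exact: open_filter_open Fo _ FA.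
  by exists A => // x [].
split.
- by move=> O [].
- by move=> O [_ [A /FU[x AUx] sAO]]; exists x; exact: sAO.
- by split; [exact: openT | exists setT => //; exact: open_filterT Fo].
- move=> O O' [oO [A FA sA]] [oO' [A' FA' sA']]; split; first exact: openI.
  exists (A `&` A'); first exact: (open_filterI Fo FA FA').
  by move=> x [[Ax A'x] Ux]; split; [exact: sA | exact: sA'].
- move=> O O' [_ [A FA sA]] oO' sOO'; split=> //.
  by exists A => //; exact: subset_trans sA sOO'.
Qed.

Lemma open_ultrafilter_closure_cover (T : topologicalType) (F : set (set T))
    (W : set (set T)) :
  open_ultrafilter F -> finite_set W -> W `<=` open ->
  setT = \bigcup_(U in W) closure U -> exists2 U, W U & F U.
Proof.
move=> Fu finW Wo covW; have [Fo _] := Fu.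
apply: contrapT => noU.
(* The condition [W U] sits under the existential so that [choice] yields a total function; outside
   [W] the value [setT] is a dummy. *)
have disjW U : exists A, W U -> F A /\ A `&` U = set0.
  have [WU|nWU] := pselect (W U); last by exists setT.
  apply: contrapT => nA; apply: noU; exists U => //.
  apply: open_ultrafilter_meets => //; first exact: Wo.
  move=> A FA; apply/set0P/negP => /eqP AU0.
  by apply: nA; exists A.
have [A AP] := choice disjW.
have [E FE sEA] := filter_base_bigcap (open_filter_base Fo) finW
  (fun U WU => (AP U WU).1).
have [x Ex] := open_filter_nonempty Fo FE.
have : (\bigcup_(U in W) closure U) x by rewrite -covW.
move=> [U WU clUx].
(* Since [E] is open, meeting [closure U] forces it to meet [U] itself. *)
have [y [Uy Ey]] := clUx _ (open_nbhs_nbhs (conj (open_filter_open Fo FE) Ex)).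
have : (A U `&` U) y by split=> //; exact: sEA Ey _ WU.
by rewrite (AP U WU).2.
Qed.

(** The filter [b x] contains both [U] and every open set around [x], so these intersect. *)
Lemma hat_subset_closure (T : topologicalType) (b : T -> EX T) (U : set T) :
  is_section b -> hat b U `<=` closure U.
Proof.
move=> hb x bU B; rewrite nbhsE => -[O [oO Ox] sOB].
have [[Fo _] _] := set_valP (b x).
have [y [Uy Oy]] :=
  open_filter_nonempty Fo (open_filterI Fo bU (hb x O oO Ox)).
by exists y; split=> //; exact: sOB.
Qed.

Lemma H_closed_adherence (T : topologicalType) (b : T -> EX T)
    (F : set (set T)) :
  H_closed T -> filter_base F -> adherence (c_op b) F !=set0.
Proof.
move=> HT Fb; apply: contrapT => adh0.
pose V := [set U : set T | open U /\ exists2 A, F A & hat b U `&` A = set0].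
have covV : open_cover V setT.
  (* A point missed by [V] would lie in the adherence. *)
  split=> [U []//|x _]; apply: contrapT => nV; apply: adh0; exists x.
  move=> A FA U oU Ux; apply/set0P/negP => /eqP UA0.
  by apply: nV; exists U => //; split=> //; exists A.
have [W [sWV finW covW]] := HT V covV.
have missW U : exists A, W U -> F A /\ hat b U `&` A = set0.
  have [/sWV[_ [A FA UA0]]|nWU] := pselect (W U); last by exists setT.
  by exists A.
have [A AP] := choice missW.
have [E FE sEA] := filter_base_bigcap Fb finW (fun U WU => (AP U WU).1).
have [_ Fne _] := Fb.
have [x Ex] := Fne E FE.
have [bx_ultra _] := set_valP (b x).
have [U WU bU] := open_ultrafilter_closure_cover bx_ultra finW
  (fun U WU => (sWV U WU).1) covW.
have : (hat b U `&` A U) x by split=> //; exact: sEA Ex _ WU.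
by rewrite (AP U WU).2.
Qed.

Lemma adherence_H_closed (T : topologicalType) (b : T -> EX T) :
  is_section b ->
  (forall F : set (set T), filter_base F -> adherence (c_op b) F !=set0) ->
  H_closed T.
Proof.
move=> hb adh V [oV covV]; apply: contrapT => nW.
pose clU (W : set (set T)) := \bigcup_(U in W) closure U.
pose F := [set A | exists W, [/\ W `<=` V, finite_set W & A = ~` clU W]].
have Fb : filter_base F.
  split.
  (* The empty subfamily provides a first member. *)
  - by exists (~` clU set0), set0; split.
  - move=> _ [W [sWV finW ->]]; apply/set0P/negP => /eqP clW.
    apply: nW; exists W; split=> //.
    by rewrite -[RHS]setCK -/(clU W) clW setC0.
  - move=> _ _ [W [sW fW ->]] [W' [sW' fW' ->]].
    exists (~` clU (W `|` W')); last by rewrite /clU bigcup_setU setCU.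
    exists (W `|` W'); split=> //; first by move=> U [/sW|/sW'].
    by rewrite finite_setU.
have [x adhx] := adh F Fb.
have [U VU Ux] := covV x I.
(* The singleton subfamily suffices: a point of [hat b U] outside [closure U] is absurd. *)
have FU : F (~` clU [set U]).
  by exists [set U]; split=> // _ ->.
have [y [bU]] := adhx _ FU U (oV U VU) Ux.
by apply; exists U => //; exact: hat_subset_closure bU.
Qed.

Theorem theorem2p21 (T : topologicalType) (hT : hausdorff_space T)
    (b' : T -> EX T) (hb' : is_section b')
    (hmin : exists K : Type, is_aLb b' K /\ is_aL' T K) :
  H_closed T <->
  (forall F : set (set T), filter_base F -> adherence (c_op b') F !=set0).
Proof.
split; last exact: adherence_H_closed.
by move=> HT F; exact: H_closed_adherence.
Qed.
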